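(* Let $X$ and $Y$ be independent real random variables, $Z\sim N(0,1)$, and $\alpha>1$. For all $a,b\in\mathbb{R}$ such that $a^2+b^2=1$, $$D_\alpha(aX+bY||Z)\leq D_\alpha(X||Z)+D_\alpha(Y||Z).$$ Equivalently, $$1+(\alpha-1)T_\alpha(aX+bY||Z)\leq\big(1+(\alpha-1)T_\alpha(X||Z)\big)\big(1+(\alpha-1)T_\alpha(Y||Z)\big).$$
   Context: With $\varphi(x)=\frac{1}{\sqrt{2\pi}}e^{-x^2/2}$, for a random variable $U$ with density $p$, $D_\alpha(U||Z)=\frac{1}{\alpha-1}\log\int_{-\infty}^\infty\frac{p(x)^\alpha}{\varphi(x)^{\alpha-1}}\,dx$ (Rényi divergence) and $T_\alpha(U||Z)=\frac{1}{\alpha-1}\Big[\int_{-\infty}^\infty\frac{p(x)^\alpha}{\varphi(x)^{\alpha-1}}\,dx-1\Big]$ (relative Tsallis entropy), with values in $[0,\infty]$; both are $\infty$ if $U$ has no density. *)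

(* Defs.v *)
From HB Require Import structures.
From mathcomp Require Import all_boot all_order all_algebra.
From mathcomp Require Import all_classical all_reals all_analysis measurable_realfun.

Set Implicit Arguments.
Unset Strict Implicit.
Unset Printing Implicit Defensive.

Import Order.TTheory GRing.Theory Num.Theory.
Import numFieldNormedType.Exports.

Local Open Scope classical_set_scope.
Local Open Scope ring_scope.
Local Open Scope ereal_scope.

Section definitions.
Context d (T : measurableType d) (R : realType) (P : probability T R).
Implicit Types (X Y U : {RV P >-> R}) (p : R -> R) (alpha : R).

Definition independent_RV X Y := forall A B : set R,
  measurable A -> measurable B ->
  P (X @^-1` A `&` Y @^-1` B) = P (X @^-1` A) * P (Y @^-1` B).

Definition is_density U p :=
  [/\ measurable_fun [set: R] p,
      (forall x, (0 <= p x)%R) &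
      forall A : set R, measurable A ->
        distribution P U A = \int[lebesgue_measure]_(x in A) (p x)%:E].

Definition has_density U := exists p, is_density U p.

(* A chosen density, meaningful only under [has_density U]; by
   [gauss_integral_densityE] below the choice is irrelevant. *)
Definition density U : R -> R := xget (cst 0%R) [set p | is_density U p].

Definition gauss_power_integral alpha p : \bar R :=
  \int[lebesgue_measure]_(x in [set: R])
    (p x `^ alpha / normal_pdf 0 1 x `^ (alpha - 1))%R%:E.

Definition renyi_divergence alpha U : \bar R :=
  if `[< has_density U >] then
    ((alpha - 1)^-1)%R%:E * lne (gauss_power_integral alpha (density U))
  else +oo.

Definition tsallis_entropy alpha U : \bar R :=
  if `[< has_density U >] then
    ((alpha - 1)^-1)%R%:E * (gauss_power_integral alpha (density U) - 1)
  else +oo.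

End definitions.

Arguments independent_RV {d T R} P X Y.
Arguments is_density {d T R} P U p.
Arguments has_density {d T R} P U.
Arguments density {d T R} P U.
Arguments renyi_divergence {d T R} P alpha U.
Arguments tsallis_entropy {d T R} P alpha U.

Lemma std_normal_pdfE (R : realType) (x : R) :
  normal_pdf 0 1 x = ((Num.sqrt (2 * pi))^-1 * expR (- x ^+ 2 / 2))%R.
Proof.
rewrite /normal_pdf oner_eq0 /normal_peak /normal_fun.
by rewrite subr0 !expr1n mul1r mulr_natl.
Qed.

Section density_choice.
Context d (T : measurableType d) (R : realType) (P : probability T R).
Implicit Types (U : {RV P >-> R}) (p q : R -> R).

Lemma density_ae_unique U p q : is_density P U p -> is_density P U q ->
  ae_eq (@lebesgue_measure R) [set: R] (EFin \o p) (EFin \o q).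
Proof.
move=> [mp p0 Up] [mq q0 Uq].
apply: integral_ae_eq => //; last by move=> E _ mE; rewrite -Up// -Uq.
- apply/integrableP; split; first exact/measurable_EFinP.
  under eq_integral do rewrite /= ger0_norm//.
  by rewrite -Up// (le_lt_trans (probability_le1 _ _))// ltry.
- exact/measurable_EFinP.
Qed.

Lemma densityP U : has_density P U -> is_density P U (density P U).
Proof.
move=> [p pU].
by apply: (@xgetPex _ (cst 0%R) [set p | is_density P U p]); exists p.
Qed.

Lemma gauss_integral_densityE alpha U p : is_density P U p ->
  gauss_power_integral alpha (density P U) = gauss_power_integral alpha p.
Proof.
move=> Up; have Ud := densityP (ex_intro _ p Up).
have mf q : is_density P U q -> measurable_fun [set: R]
    (fun x => (q x `^ alpha / normal_pdf 0 1 x `^ (alpha - 1))%R%:E).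
  move=> [mq _ _]; apply/measurable_EFinP; apply: measurable_funM.
    exact: (@measurableT_comp _ _ _ _ _ _ (@powR R ^~ alpha)).
  under eq_fun do rewrite -powRN.
  apply: (@measurableT_comp _ _ _ _ _ _ (@powR R ^~ (- (alpha - 1))%R)) => //.
  exact: measurable_normal_pdf.
apply: ge0_ae_eq_integral => //; try exact: mf.
- by move=> x _; rewrite lee_fin divr_ge0// powR_ge0.
- by move=> x _; rewrite lee_fin divr_ge0// powR_ge0.
- apply: filterS (density_ae_unique Ud Up) => x /= pq _.
  by have [->] := pq I.
Qed.

End density_choice.

(* Main.v *)
From HB Require Import structures.
From mathcomp Require Import all_boot all_order all_algebra.
From mathcomp Require Import all_classical all_reals all_analysis measurable_realfun.
From mathcomp Require Import ring.
Require Import Defs.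

Set Implicit Arguments.
Unset Strict Implicit.
Unset Printing Implicit Defensive.

Import Order.TTheory GRing.Theory Num.Theory.
Import numFieldNormedType.Exports.

Local Open Scope classical_set_scope.
Local Open Scope ring_scope.
Local Open Scope ereal_scope.

(* For a^2 + b^2 = 1 the map (x, y) = (a u - b v, b u + a v) is a rotation, so it
   preserves Lebesgue measure on the plane and the product of the standard
   normal densities: phi(x) phi(y) = phi(u) phi(v).  Hence U = a X + b Y has
   density r(u) = int p(x) q(y) dv, and Jensen's inequality for the weight
   phi(v) dv gives
     r(u)^alpha <= int (p(x) q(y))^alpha / phi(v)^(alpha - 1) dv.
   Dividing by phi(u)^(alpha - 1), integrating in u and rotating back bounds the
   power integral of r by the product of those of p and q.  The same Jensen
   inequality makes each power integral at least 1, which settles the case where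
   X or Y has no density. *)

(** * Affine substitution on the line and invariance of plane integrals under rotation *)

Section lebesgue_change_of_variables.
Context (R : realType).
Notation mu := (@lebesgue_measure R).

Lemma measurable_affine (c d : R) :
  measurable_fun [set: R] ((fun x => c * x + d)%R : R -> measurableTypeR R).
Proof. by apply: measurable_funD => //; exact: measurable_funM. Qed.

(** Lebesgue measure is determined by its values on half-open intervals, so only their preimages
    need measuring. A negative [c] moves the closed end to the left, which does not affect the
    length. *)
Lemma lebesgue_measure_affine (c d : R) (A : set R) : c != 0%R ->
  measurable A ->
  mu A = `|c|%:E * mu ((fun x => c * x + d)%R @^-1` A).
Proof.
move=> c0 mA.
pose nu : {measure set (measurableTypeR R) -> \bar R} :=
  mscale (NngNum (normr_ge0 c))
    (pushforward mu ((fun x => c * x + d)%R : R -> measurableTypeR R)).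
rewrite (@lebesgue_measure_unique R (nu (measurable_affine c d)))// => _ [[l r]] _ <-.
change (mu `]l, r]%classic =
  `|c|%:E * mu ((fun x => c * x + d)%R @^-1` `]l, r]%classic)).
move: c0; rewrite neq_lt => /orP[c0|c0].
- have -> : (fun x => c * x + d)%R @^-1` `]l, r]%classic =
    `[((r - d) / c)%R, ((l - d) / c)%R[%classic.
    apply/seteqP; split => x /=; rewrite !in_itv/=;
    by rewrite ler_ndivrMr// ltr_ndivlMr// lerBrDr ltrBlDr mulrC andbC.
  rewrite !lebesgue_measure_itv/= !lte_fin ltr_nM2r ?invr_lt0// ltrD2r ltr0_norm//.
  case: ifPn => // _; last by rewrite mule0.
  by rewrite -!EFinB -EFinM; congr EFin; field; rewrite lt_eqF.
- have -> : (fun x => c * x + d)%R @^-1` `]l, r]%classic =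
    `]((l - d) / c)%R, ((r - d) / c)%R]%classic.
    apply/seteqP; split => x /=; rewrite !in_itv/=;
    by rewrite ler_pdivlMr// ltr_pdivrMr// lerBrDr ltrBlDr mulrC.
  rewrite !lebesgue_measure_itv/= !lte_fin ltr_pM2r ?invr_gt0// ltrD2r gtr0_norm//.
  case: ifPn => // _; last by rewrite mule0.
  by rewrite -!EFinB -EFinM; congr EFin; field; rewrite gt_eqF.
Qed.

Lemma ge0_integral_affine (c d : R) (f : R -> \bar R) : c != 0%R ->
  measurable_fun [set: R] f -> (forall x, 0 <= f x) ->
  \int[mu]_x f x = `|c|%:E * \int[mu]_x f (c * x + d)%R.
Proof.
move=> c0 mf f0.
pose nu : {measure set (measurableTypeR R) -> \bar R} :=
  mscale (NngNum (normr_ge0 c))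
    (pushforward mu ((fun x => c * x + d)%R : R -> measurableTypeR R)).
rewrite (@eq_measure_integral _ _ _ _ (nu (measurable_affine c d))); last first.
  by move=> A mA _; exact: lebesgue_measure_affine.
by rewrite ge0_integral_mscale//= ge0_integral_pushforward//; exact: measurable_affine.
Qed.

(** For [a != 0] two shears do the work: one affine substitution per variable, with Tonelli
    exchanging the order in between. Each side acquires the same factor [|a^-1|], so no Jacobian is
    left over. *)
Lemma ge0_integral_rotation (a b : R) (F : R * R -> \bar R) :
  (a ^+ 2 + b ^+ 2 = 1)%R ->
  measurable_fun [set: R * R] F -> (forall z, 0 <= F z) ->
  \int[mu]_u \int[mu]_v F (a * u - b * v, b * u + a * v)%R =
  \int[mu]_x \int[mu]_y F (x, y).
Proof.
move=> ab mF F0.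
have mlin (k l m n : R) : measurable_fun [set: R * R]
    (fun z : R * R => F (k * z.1 + l * z.2, m * z.1 + n * z.2)%R).
  apply: measurableT_comp => //; apply/measurable_fun_pairP; split => /=.
    by apply: measurable_funD; exact: measurable_funM.
  by apply: measurable_funD; exact: measurable_funM.
have msec1 (f g : R -> R) : measurable_fun [set: R] f ->
    measurable_fun [set: R] g -> measurable_fun [set: R] (fun x => F (f x, g x)).
  by move=> mf mg; apply: measurableT_comp => //; apply/measurable_fun_pairP.
(* The shears divide by [a]. For [a = 0] one has [b = 1] or [b = -1], and the rotation is a
   coordinate swap up to signs. *)
have [a0|a0] := eqVneq a 0%R.
  have b1 : (b * b = 1)%R by move: ab; rewrite a0 expr0n add0r expr2.
  have b0 : (- b != 0)%R.
    by rewrite oppr_eq0; apply: contra_eq_neq b1 => ->; rewrite mul0r eq_sym oner_eq0.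
  have nb1 : (`|b| = 1)%R.
    by apply/eqP; rewrite -(@eqrXn2 _ 2)// ?expr1n// -normrX expr2 b1 normr1.
  transitivity (\int[mu]_u \int[mu]_x F (x, b * u)%R).
    apply: eq_integral => u _.
    rewrite (@ge0_integral_affine (- b) 0 (fun x => F (x, b * u)%R))//; last exact: msec1.
    rewrite normrN nb1 mul1e; apply: eq_integral => v _.
    by rewrite a0 !mul0r sub0r !addr0 mulNr.
  rewrite -(@fubini_tonelli _ _ _ _ _ mu mu (fun z => F (z.1, b * z.2)%R))//; last first.
    have := mlin 1%R 0%R 0%R b; congr (measurable_fun _ _).
    by apply/funext => z; rewrite mul1r !mul0r addr0 add0r.
  apply: eq_integral => x _ /=.
  rewrite oppr_eq0 in b0.
  rewrite [RHS](@ge0_integral_affine b 0)//; last exact: msec1.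
  by rewrite nb1 mul1e; apply: eq_integral => u _; rewrite addr0.
have ai0 : (a^-1 != 0)%R by rewrite invr_eq0.
rewrite (@fubini_tonelli _ _ _ _ _ mu mu
  (fun z => F (a * z.1 - b * z.2, b * z.1 + a * z.2)%R))//; last first.
  have := mlin a (- b)%R b a; congr (measurable_fun _ _).
  by apply/funext => z; rewrite mulNr.
(* Substitute [x = a u - b v] at fixed [v]. The coefficient of [v] in the second coordinate becomes
   [(b^2 + a^2) / a = a^-1]. *)
transitivity (\int[mu]_v (`|a^-1|%:E * \int[mu]_x F (x, b / a * x + a^-1 * v)%R)).
  apply: eq_integral => v _ /=.
  rewrite (@ge0_integral_affine a^-1 (b / a * v)%R)//; last first.
    apply: msec1.
      by apply: measurable_funB => //; exact: measurable_funM.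
    by apply: measurable_funD => //; exact: measurable_funM.
  congr (_ * _); apply: eq_integral => x _; congr (F (_, _)).
    by field.
  have aE : (a = (1 - b ^+ 2) / a)%R by rewrite -ab addrK expr2 mulfK.
  by rewrite [X in (_ + X * v)%R]aE; field.
have mG : measurable_fun [set: R * R] (fun z : R * R => F (z.1, b / a * z.1 + a^-1 * z.2)%R).
  have := mlin 1%R 0%R (b / a)%R (a^-1)%R; congr (measurable_fun _ _).
  by apply/funext => z; rewrite mul1r !mul0r addr0.
rewrite ge0_integralZl//; last 2 first.
  exact: (@measurable_fun_fubini_tonelli_G _ _ _ _ _ mu _ mG).
  by move=> v _; exact: integral_ge0.
rewrite -(@fubini_tonelli _ _ _ _ _ mu mu _ mG)//.
rewrite -ge0_integralZl//; last 2 first.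
  exact: (@measurable_fun_fubini_tonelli_F _ _ _ _ _ mu _ mG).
  by move=> v _; exact: integral_ge0.
apply: eq_integral => x _ /=.
(* The second shear, [y = a^-1 v + (b / a) x] at fixed [x], is applied to the right-hand side. *)
rewrite [RHS](@ge0_integral_affine a^-1 (b / a * x)%R)//; last exact: msec1.
by congr (_ * _); apply: eq_integral => v _; rewrite addrC.
Qed.

End lebesgue_change_of_variables.

(** * Jensen's inequality for the power integral with Gaussian weight *)

Section gaussian_power_integral.
Context (R : realType).
Notation mu := (@lebesgue_measure R).

Lemma std_normal_pdf_gt0 (x : R) : (0 < normal_pdf 0 1 x)%R.
Proof.
by rewrite std_normal_pdfE mulr_gt0 ?expR_gt0// invr_gt0 sqrtr_gt0 mulr_gt0 ?pi_gt0.
Qed.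

Lemma std_normal_pdf_rotation (a b u v : R) : (a ^+ 2 + b ^+ 2 = 1)%R ->
  (normal_pdf 0 1 (a * u - b * v) * normal_pdf 0 1 (b * u + a * v) =
   normal_pdf 0 1 u * normal_pdf 0 1 v)%R.
Proof.
move=> ab; rewrite !std_normal_pdfE !(mulrACA _ (expR _)) -!expRD.
congr (_ * expR _)%R.
transitivity (- ((a ^+ 2 + b ^+ 2) * (u ^+ 2 + v ^+ 2)) / 2)%R; first by field.
by rewrite ab; field.
Qed.

Lemma measurable_gauss_power (alpha : R) (p : R -> R) :
  measurable_fun [set: R] p ->
  measurable_fun [set: R] (fun x => p x `^ alpha / normal_pdf 0 1 x `^ (alpha - 1))%R.
Proof.
move=> mp; apply: measurable_funM.
  exact: (@measurableT_comp _ _ _ _ _ _ (@powR R ^~ alpha)).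
under eq_fun do rewrite -powRN.
apply: (@measurableT_comp _ _ _ _ _ _ (@powR R ^~ (- (alpha - 1))%R)) => //.
exact: measurable_normal_pdf.
Qed.

Lemma gauss_power_ge0 (alpha : R) (p : R -> R) (x : R) :
  (0 <= p x `^ alpha / normal_pdf 0 1 x `^ (alpha - 1))%R.
Proof. by rewrite divr_ge0 ?powR_ge0. Qed.

Lemma gauss_power_integral_ge0 (alpha : R) (p : R -> R) :
  0 <= gauss_power_integral alpha p.
Proof. by apply: integral_ge0 => x _; rewrite lee_fin gauss_power_ge0. Qed.

(** Meant for [s], [t] the values of the two densities and [x], [y], [u], [v] those of the normal
    density at the rotated and original coordinates: the part depending on [u] alone can then leave
    the integral over [v]. *)
Lemma powR_ratioM (alpha beta s t x y u v : R) :
  (0 <= s)%R -> (0 <= t)%R -> (0 <= x)%R -> (0 <= y)%R ->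
  (0 <= u)%R -> (0 <= v)%R -> (x * y = u * v)%R ->
  (s `^ alpha / x `^ beta * (t `^ alpha / y `^ beta) =
   (u `^ beta)^-1 * ((s * t) `^ alpha / v `^ beta))%R.
Proof.
move=> s0 t0 x0 y0 u0 v0 xyuv.
rewrite mulrACA -invfM -(powRM _ s0 t0) -(powRM _ x0 y0) xyuv (powRM _ u0 v0) invfM.
by rewrite mulrCA.
Qed.

(** This is the tangent to the power function at 1; it follows from Young's inequality for [t] and 1
    with exponents [alpha] and [alpha / (alpha - 1)]. *)
Lemma powR_ge_tangent (alpha t : R) : (1 < alpha)%R -> (0 <= t)%R ->
  (alpha * t <= t `^ alpha + (alpha - 1))%R.
Proof.
move=> a1 t0; have a0 : (0 < alpha)%R by exact: lt_trans a1.
have b0 : (0 < alpha - 1)%R by rewrite subr_gt0.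
have := @conjugate_powR R t 1%R alpha (alpha / (alpha - 1))%R t0 ler01 a0.
rewrite divr_gt0// powR1 mulr1 invf_div mul1r => /(_ isT) H.
rewrite mulrC -ler_pdivlMr// mulrDl H//.
by field; rewrite gt_eqF.
Qed.

(* Young's inequality at [t = y / (m * g)], cleared of denominators. *)
Lemma weighted_powR_ge (alpha m y g : R) : (1 < alpha)%R -> (0 < m)%R ->
  (0 <= y)%R -> (0 < g)%R ->
  (alpha * m `^ (alpha - 1) * y <=
   y `^ alpha / g `^ (alpha - 1) + (alpha - 1) * m `^ alpha * g)%R.
Proof.
move=> a1 m0 y0 g0.
have a0 : (0 < alpha)%R by exact: lt_trans a1.
have mg0 : (0 <= m * g)%R by rewrite mulr_ge0// ltW.
have := @powR_ge_tangent alpha (y / (m * g))%R a1 (divr_ge0 y0 mg0).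
have k0 : (0 < m `^ alpha * g)%R by rewrite mulr_gt0// powR_gt0.
rewrite -(ler_pM2r k0) powRM ?invr_ge0//.
have -> : ((m * g)^-1 `^ alpha = (m `^ alpha * g `^ alpha)^-1)%R.
  by rewrite -(powRM _ (ltW m0) (ltW g0)) -(powR_inv1 mg0) -powRrM mulN1r powRN.
(* Splitting one factor off the powers of [m] and [g] leaves a rational identity in the atoms named
   next. *)
rewrite -(mulr_powRB1 (ltW m0) a0) -(mulr_powRB1 (ltW g0) a0).
set Y := (y `^ alpha)%R; set M := (m `^ _)%R; set G := (g `^ _)%R.
have G0 : (0 < G)%R by exact: powR_gt0.
have M0 : (0 < M)%R by exact: powR_gt0.
by congr (is_true (_ <= _)%R); field; rewrite ?gt_eqF.
Qed.

(** Integrate [weighted_powR_ge] with [g] the normal density. Since that density has mass 1,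
    [alpha * m^alpha] is at most the power integral plus [(alpha - 1) * m^alpha]. *)
Lemma gauss_power_integral_ge (alpha m : R) (f : R -> R) : (1 < alpha)%R ->
  measurable_fun [set: R] f -> (forall x, (0 <= f x)%R) ->
  \int[mu]_x (f x)%:E = m%:E ->
  (m `^ alpha)%:E <= gauss_power_integral alpha f.
Proof.
move=> a1 mf f0 fm.
have a0 : (0 < alpha)%R by exact: lt_trans a1.
have : (0 <= m)%R.
  by rewrite -lee_fin -fm; apply: integral_ge0 => x _; rewrite lee_fin.
(* The pointwise inequality needs [m > 0]; for [m = 0] the bound is just [0]. *)
rewrite le_eqVlt => /predU1P[<-|m0].
  by rewrite powR0 ?gt_eqF// gauss_power_integral_ge0.
have b0 : (0 <= alpha - 1)%R by rewrite subr_ge0 ltW.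
have mg := measurable_gauss_power alpha mf.
have M0 := powR_ge0 m.
have mpdf : measurable_fun [set: R] (normal_pdf (0 : R) 1) by exact: measurable_normal_pdf.
have : \int[mu]_x ((alpha * m `^ (alpha - 1))%:E * (f x)%:E) <=
   \int[mu]_x ((f x `^ alpha / normal_pdf 0 1 x `^ (alpha - 1))%:E +
      ((alpha - 1) * m `^ alpha)%:E * (normal_pdf 0 1 x)%:E).
  apply: ge0_le_integral => //.
  - by move=> x _; rewrite mule_ge0// lee_fin// mulr_ge0// ltW.
  - apply/measurable_EFinP; exact: measurable_funM.
  - apply/measurable_EFinP; apply: measurable_funD => //; exact: measurable_funM.
  - move=> x _; rewrite -!EFinM -EFinD lee_fin.
    by apply: weighted_powR_ge => //; exact: std_normal_pdf_gt0.
rewrite ge0_integralD//; last 4 first.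
  by move=> x _; rewrite lee_fin gauss_power_ge0.
  exact/measurable_EFinP.
  by move=> x _; rewrite mule_ge0 ?lee_fin ?mulr_ge0 ?normal_pdf_ge0.
  by apply/measurable_EFinP; exact: measurable_funM.
rewrite !ge0_integralZl//; last 6 first.
  exact/measurable_EFinP.
  by move=> x _; rewrite lee_fin.
  by rewrite lee_fin mulr_ge0// ltW.
  exact/measurable_EFinP.
  by move=> x _; rewrite lee_fin normal_pdf_ge0.
  by rewrite lee_fin mulr_ge0.
rewrite fm integral_normal_pdf mule1 -EFinM -mulrA (mulrC (m `^ _)%R) (mulr_powRB1 (ltW m0) a0).
rewrite -leeBlDr// -EFinB; congr (_%:E <= _); ring.
Qed.

End gaussian_power_integral.

(** * The measure with a given density *)

Section density_measure.
Context d (T : measurableType d) (R : realType).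
Variables (m : {measure set T -> \bar R}) (f : T -> \bar R).
Hypotheses (mf : measurable_fun [set: T] f) (f0 : forall x, 0 <= f x).

(** Made an actual measure so that uniqueness of product measures applies to the candidate joint
    law. *)
Definition density_measure (A : set T) : \bar R := \int[m]_(x in A) f x.

Let density_measure0 : density_measure set0 = 0.
Proof. exact: integral_set0. Qed.

Let density_measure_ge0 A : 0 <= density_measure A.
Proof. exact: integral_ge0. Qed.

Let density_measure_sigma_additive : semi_sigma_additive density_measure.
Proof.
move=> /= F mF tF mUF; rewrite /density_measure; apply: cvg_toP.
  apply: ereal_nondecreasing_is_cvgn => k n kn.
  by apply: lee_sum_nneg_natr => // i _ _; exact: integral_ge0.
by rewrite ge0_integral_bigcup//=; exact: measurable_funTS.
Qed.

HB.instance Definition _ := isMeasure.Build _ _ _ density_measure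
  density_measure0 density_measure_ge0 density_measure_sigma_additive.

End density_measure.

(** * The joint density of an independent pair and the density of its rotated sum *)

Section rotated_density.
Context d (T : measurableType d) (R : realType) (P : probability T R).
Notation mu := (@lebesgue_measure R).

Lemma measurable_joint_density (p q : R -> R) :
  measurable_fun [set: R] p -> measurable_fun [set: R] q ->
  measurable_fun [set: R * R] (fun z => (p z.1 * q z.2)%:E).
Proof.
move=> mp mq; apply/measurable_EFinP.
by apply: measurable_funM; exact: measurableT_comp.
Qed.

Lemma ge0_integral_prodM (f g : R -> \bar R) :
  measurable_fun [set: R] f -> (forall x, 0 <= f x) ->
  measurable_fun [set: R] g -> (forall x, 0 <= g x) ->
  \int[mu]_x \int[mu]_y (f x * g y) = \int[mu]_x f x * \int[mu]_y g y.
Proof.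
move=> mf f0 mg g0.
under eq_integral do rewrite ge0_integralZl//.
by rewrite ge0_integralZr//; exact: integral_ge0.
Qed.

(** The law of the pair and the measure with density [p(x) q(y)] both agree on rectangles with the
    product of the two distributions, so both equal that product. *)
Lemma joint_density (X Y : {RV P >-> R}) (p q : R -> R) :
  independent_RV P X Y -> is_density P X p -> is_density P Y q ->
  forall S : set (R * R), measurable S ->
  P ((fun w => (X w, Y w)) @^-1` S) =
  \int[(mu \x mu)%E]_(z in S) (p z.1 * q z.2)%:E.
Proof.
move=> XY [mp p0 Xp] [mq q0 Yq] S mS.
have mpq := measurable_joint_density mp mq.
have pq0 (z : R * R) : 0 <= (p z.1 * q z.2)%:E by rewrite lee_fin mulr_ge0.
have mXY : measurable_fun [set: T] (fun w => (X w, Y w)).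
  by apply/measurable_fun_pairP; split; exact: measurable_funPT.
pose law : {measure set (R * R) -> \bar R} := pushforward P (fun w => (X w, Y w)).
pose dens : {measure set (measurableTypeR R * measurableTypeR R) -> \bar R} :=
  density_measure (mu \x mu)%E (fun z : R * R => (p z.1 * q z.2)%:E).
have lawE : (distribution P X \x distribution P Y)%E S = law mXY S.
  by apply: product_measure_unique => // A B mA mB; exact: XY.
rewrite -[LHS]/(law mXY S) -lawE.
(* [R] and [measurableTypeR R] carry the same measurable sets but different
   displays; pushing along the identity moves [dens] to the display of [law]. *)
have mid : measurable_fun [set: measurableTypeR R * measurableTypeR R]
    (idfun : measurableTypeR R * measurableTypeR R -> R * R).
  by move=> _ A mA; rewrite setTI.
pose dens' : {measure set (R * R) -> \bar R} :=
  pushforward (dens mpq pq0)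
    (idfun : measurableTypeR R * measurableTypeR R -> R * R).
rewrite -[RHS]/(dens' mid S).
apply: product_measure_unique => // A B mA mB.
rewrite [RHS]/= Xp// Yq//.
(* With [p] and [q] extended by zero outside [A] and [B], the integrand on the rectangle factors
   over the whole plane and Tonelli applies. *)
have mpA : measurable_fun [set: R] ((EFin \o p) \_ A).
  by apply/(measurable_restrictT _ mA)/measurable_funTS/measurable_EFinP.
have mqB : measurable_fun [set: R] ((EFin \o q) \_ B).
  by apply/(measurable_restrictT _ mB)/measurable_funTS/measurable_EFinP.
rewrite -[LHS]/(density_measure _ _ _) /density_measure integral_mkcond.
rewrite [X in _ = X * _]integral_mkcond [X in _ = _ * X]integral_mkcond.
rewrite -ge0_integral_prodM//; last 2 first.
  by move=> x; rewrite patchE; case: ifPn => // _; rewrite lee_fin.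
  by move=> x; rewrite patchE; case: ifPn => // _; rewrite lee_fin.
rewrite fubini_tonelli1//; last 2 first.
  apply/(measurable_restrictT _ (measurableX mA mB)).
  exact: measurable_funTS.
  by move=> x; rewrite patchE; case: ifPn.
apply: eq_integral => x _; apply: eq_integral => y _; rewrite !patchE in_setX/=.
by case: (x \in A); case: (y \in B); rewrite ?mule0 ?mul0e ?EFinM.
Qed.

Section rotation.
Variables (a b : R) (p q : R -> R).
Hypothesis ab : (a ^+ 2 + b ^+ 2 = 1)%R.
Hypotheses (mp : measurable_fun [set: R] p) (mq : measurable_fun [set: R] q).
Hypotheses (p0 : forall x, (0 <= p x)%R) (q0 : forall x, (0 <= q x)%R).

Let rot (z : R * R) : R * R := (a * z.1 - b * z.2, b * z.1 + a * z.2)%R.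

Let measurable_rot : measurable_fun [set: R * R] rot.
Proof.
apply/measurable_fun_pairP; split.
  by apply: measurable_funB; exact: measurable_funM.
by apply: measurable_funD; exact: measurable_funM.
Qed.

(** For independent variables with densities [p] and [q], this is the joint density of
    [(a X + b Y, a Y - b X)]. *)
Definition rotated_joint (u v : R) : R :=
  (p (a * u - b * v) * q (b * u + a * v))%R.

Definition rotated_marginal (u : R) : \bar R :=
  \int[mu]_v (rotated_joint u v)%:E.

(* [fine] sends the null set where the marginal is infinite to [0]. *)
Definition rotated_density (u : R) : R := fine (rotated_marginal u).

Lemma rotated_joint_ge0 u v : (0 <= rotated_joint u v)%R.
Proof. exact: mulr_ge0. Qed.

Lemma measurable_rotated_joint2 :
  measurable_fun [set: R * R] (fun z => (rotated_joint z.1 z.2)%:E).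
Proof. exact: (measurableT_comp (measurable_joint_density mp mq) measurable_rot). Qed.

Lemma measurable_rotated_joint u : measurable_fun [set: R] (rotated_joint u).
Proof.
apply/measurable_EFinP.
exact: (measurableT_comp measurable_rotated_joint2 (measurable_pair1 u)).
Qed.

Lemma rotated_marginal_ge0 u : 0 <= rotated_marginal u.
Proof. by apply: integral_ge0 => v _; rewrite lee_fin rotated_joint_ge0. Qed.

Lemma measurable_rotated_marginal : measurable_fun [set: R] rotated_marginal.
Proof.
apply: (@measurable_fun_fubini_tonelli_F _ _ _ _ _ mu _ measurable_rotated_joint2).
by move=> z; rewrite lee_fin rotated_joint_ge0.
Qed.

Lemma rotated_density_ge0 u : (0 <= rotated_density u)%R.
Proof. by rewrite fine_ge0// rotated_marginal_ge0. Qed.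

Lemma measurable_rotated_density : measurable_fun [set: R] rotated_density.
Proof. exact: (measurableT_comp _ measurable_rotated_marginal). Qed.

Lemma gauss_power_integral_rotated_density (alpha : R) : (1 < alpha)%R ->
  gauss_power_integral alpha rotated_density <=
  gauss_power_integral alpha p * gauss_power_integral alpha q.
Proof.
move=> a1.
pose g (f : R -> R) x := (f x `^ alpha / normal_pdf 0 1 x `^ (alpha - 1))%R.
have g0 f x : (0 <= g f x)%R by exact: gauss_power_ge0.
have mg f : measurable_fun [set: R] f -> measurable_fun [set: R] (g f).
  exact: measurable_gauss_power.
rewrite -ge0_integral_prodM//; last 4 first.
  by apply/measurable_EFinP; exact: mg.
  by move=> x; rewrite lee_fin g0.
  by apply/measurable_EFinP; exact: mg.
  by move=> x; rewrite lee_fin g0.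
have mgg := measurable_joint_density (mg _ mp) (mg _ mq).
have gg0 (z : R * R) : 0 <= (g p z.1 * g q z.2)%:E by rewrite lee_fin mulr_ge0.
under [leRHS]eq_integral do under eq_integral do rewrite -EFinM.
rewrite -(ge0_integral_rotation ab mgg gg0).
have mggr : measurable_fun [set: R * R] (fun z => (g p (rot z).1 * g q (rot z).2)%:E).
  exact: measurableT_comp mgg measurable_rot.
have mF := @measurable_fun_fubini_tonelli_F _ _ _ _ _ mu _ mggr (fun z => gg0 (rot z)).
apply: ge0_le_integral => //.
- by move=> u _; rewrite lee_fin gauss_power_ge0.
- apply/measurable_EFinP; exact: (mg _ measurable_rotated_density).
- move=> u _.
  (* Where the marginal is infinite, [rotated_density u] is [0], so the left integrand vanishes. *)
  have [finu|inffu] := boolP (rotated_marginal u \is a fin_num); last first.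
    rewrite /rotated_density; have -> : rotated_marginal u = +oo.
      by move: inffu; rewrite ge0_fin_numE ?rotated_marginal_ge0// -leNgt leye_eq => /eqP.
    rewrite /= powR0 ?mul0r; last by rewrite gt_eqF// (lt_trans ltr01).
    by apply: integral_ge0 => v _; rewrite lee_fin mulr_ge0.
  pose c := ((normal_pdf 0 1 u `^ (alpha - 1))^-1)%R.
  have c0 : (0 <= c)%R by rewrite invr_ge0 powR_ge0.
  have -> : \int[mu]_v (g p (rot (u, v)).1 * g q (rot (u, v)).2)%:E =
      c%:E * gauss_power_integral alpha (rotated_joint u).
    have gu0 v : [set: R] v -> 0 <= (g (rotated_joint u) v)%:E by rewrite lee_fin g0.
    have mgu : measurable_fun [set: R] (fun v => (g (rotated_joint u) v)%:E).
      by apply/measurable_EFinP; exact: (mg _ (measurable_rotated_joint u)).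
    rewrite -[RHS](@ge0_integralZl_EFin _ _ _ mu _ measurableT _ gu0 mgu c c0).
    apply: eq_integral => v _; rewrite -EFinM.
    apply: (congr1 EFin); apply: powR_ratioM; last exact: std_normal_pdf_rotation.
    - exact: p0.
    - exact: q0.
    1-4: exact: normal_pdf_ge0.
  (* Jensen in [v], with [m] the mass [rotated_density u] of [rotated_joint u]; finiteness of the
     marginal lets [fine] be undone. *)
  rewrite mulrC EFinM lee_wpmul2l// gauss_power_integral_ge//.
  - exact: measurable_rotated_joint.
  - exact: rotated_joint_ge0.
  - by rewrite -[LHS]/(rotated_marginal u) /rotated_density fineK.
Qed.

Lemma rotated_densityP (X Y : {RV P >-> R}) :
  independent_RV P X Y -> is_density P X p -> is_density P Y q ->
  is_density P (a *: X + b *: Y)%R rotated_density.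
Proof.
move=> XY Xp Yq; split.
- exact: measurable_rotated_density.
- exact: rotated_density_ge0.
have marg A : measurable A ->
    distribution P (a *: X + b *: Y)%R A = \int[mu]_(u in A) rotated_marginal u.
  move=> mA.
  pose S := (fun z : R * R => (a * z.1 + b * z.2)%R) @^-1` A.
  have mS : measurable S.
    rewrite -[S]setTI; have : measurable_fun [set: R * R] (fun z => a * z.1 + b * z.2)%R.
      by apply: measurable_funD; exact: measurable_funM.
    exact.
  rewrite -[LHS]/(P ((fun w => (X w, Y w)) @^-1` S)) (joint_density XY Xp Yq mS).
  have mpq := measurable_joint_density mp mq.
  have mpqS : measurable_fun [set: R * R] ((fun z => (p z.1 * q z.2)%:E) \_ S).
    by apply/(measurable_restrictT _ mS); exact: measurable_funTS.
  have pqS0 z : 0 <= ((fun z => (p z.1 * q z.2)%:E) \_ S) z.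
    by rewrite patchE; case: ifPn => // _; rewrite lee_fin mulr_ge0.
  rewrite integral_mkcond fubini_tonelli1// -(ge0_integral_rotation ab mpqS pqS0).
  rewrite [RHS]integral_mkcond; apply: eq_integral => u _.
  (* At the rotated point [a x + b y = u], so in the new coordinates [S] is the strip over [A] and
     the inner integral is the marginal or zero. *)
  have SE v : (rot (u, v) \in S) = (u \in A).
    have E : (a * (rot (u, v)).1 + b * (rot (u, v)).2 = u)%R.
      transitivity ((a ^+ 2 + b ^+ 2) * u)%R; first by rewrite /=; ring.
      by rewrite ab mul1r.
    have SA : S (rot (u, v)) = A u by rewrite -[RHS](congr1 A E).
    by apply/idP/idP => /set_mem H; apply/mem_set; move: H; rewrite SA.
  rewrite patchE; case: ifPn => uA.
    by apply: eq_integral => v _; rewrite patchE (SE v) uA.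
  under eq_integral do rewrite patchE (SE _) (negbTE uA).
  exact: integral0.
move=> A mA; rewrite marg//; apply: ae_eq_integral => //.
- by apply: measurable_funTS; exact: measurable_rotated_marginal.
- by apply: measurable_funTS; apply/measurable_EFinP; exact: measurable_rotated_density.
(* The marginal has total mass 1, hence is finite almost everywhere, and [fine] alters it only on a
   null set. *)
have intr : mu.-integrable [set: R] rotated_marginal.
  apply/integrableP; split; first exact: measurable_rotated_marginal.
  under eq_integral do rewrite gee0_abs ?rotated_marginal_ge0//.
  by rewrite -marg// probability_setT ltry.
have := integrable_ae measurableT intr.
by apply: filterS => u fu _; rewrite /= /rotated_density fineK// fu.
Qed.

End rotation.

End rotated_density.

(** * From power integrals to the two divergences *)

Section divergences.
Context d (T : measurableType d) (R : realType) (P : probability T R).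
Variable alpha : R.
Hypothesis alpha_gt1 : (1 < alpha)%R.

Lemma gauss_power_integral_density_ge1 (U : {RV P >-> R}) (p : R -> R) :
  is_density P U p -> 1 <= gauss_power_integral alpha p.
Proof.
move=> [mp p0 Up].
have p1 : \int[lebesgue_measure]_x (p x)%:E = 1%R%:E.
  by rewrite -Up// probability_setT.
by have := gauss_power_integral_ge alpha_gt1 mp p0 p1; rewrite powR1.
Qed.

(** Reduces the Tsallis form to the bare power integral; the cancellation of 1 remains valid when
    that integral is [+oo]. *)
Lemma tsallis_entropyE (U : {RV P >-> R}) :
  1 + (alpha - 1)%R%:E * tsallis_entropy P alpha U =
  if `[< has_density P U >] then gauss_power_integral alpha (density P U)
  else +oo.
Proof.
have b0 : (0 < alpha - 1)%R by rewrite subr_gt0.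
rewrite /tsallis_entropy; case: asboolP => [dU|_]; last first.
  by rewrite gt0_muley ?lte_fin// addey.
rewrite muleA -EFinM divff ?gt_eqF// mul1e addeC subeK//.
Qed.

(** Rules out [-oo], so that a sum with one infinite divergence is [+oo]. *)
Lemma renyi_divergence_ge0 (U : {RV P >-> R}) : 0 <= renyi_divergence P alpha U.
Proof.
rewrite /renyi_divergence; case: asboolP => // dU.
apply: mule_ge0; first by rewrite lee_fin invr_ge0 subr_ge0 ltW.
by rewrite lne_ge0; exact: gauss_power_integral_density_ge1 (densityP dU).
Qed.

Lemma gauss_power_integral_rotation_le (a b : R) (X Y : {RV P >-> R}) :
  (a ^+ 2 + b ^+ 2 = 1)%R -> independent_RV P X Y ->
  has_density P X -> has_density P Y ->
  has_density P (a *: X + b *: Y)%R /\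
  gauss_power_integral alpha (density P (a *: X + b *: Y)%R) <=
  gauss_power_integral alpha (density P X) *
  gauss_power_integral alpha (density P Y).
Proof.
move=> ab XY /densityP Xp /densityP Yq.
have [mp p0 _] := Xp; have [mq q0 _] := Yq.
have dens := rotated_densityP ab mp mq p0 q0 XY Xp Yq.
split; first by exists (rotated_density a b (density P X) (density P Y)).
rewrite (gauss_integral_densityE alpha dens).
exact: gauss_power_integral_rotated_density.
Qed.

Lemma renyi_divergence_rotation_le (a b : R) (X Y : {RV P >-> R}) :
  (a ^+ 2 + b ^+ 2 = 1)%R -> independent_RV P X Y ->
  renyi_divergence P alpha (a *: X + b *: Y)%R <=
  renyi_divergence P alpha X + renyi_divergence P alpha Y.
Proof.
move=> ab XY.
have [dX|dX] := pselect (has_density P X); last first.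
  rewrite [X in _ <= X + _]/renyi_divergence (asboolF dX) addye ?leey//.
  by rewrite -ltNye (lt_le_trans (ltNyr 0%R)) ?renyi_divergence_ge0.
have [dY|dY] := pselect (has_density P Y); last first.
  rewrite [X in _ <= _ + X]/renyi_divergence (asboolF dY) addey ?leey//.
  by rewrite -ltNye (lt_le_trans (ltNyr 0%R)) ?renyi_divergence_ge0.
have [dZ] := gauss_power_integral_rotation_le ab XY dX dY.
have := gauss_power_integral_density_ge1 (densityP dX).
have := gauss_power_integral_density_ge1 (densityP dY).
rewrite /renyi_divergence (asboolT dX) (asboolT dY) (asboolT dZ).
move: (gauss_power_integral _ _) (gauss_power_integral _ _)
  (gauss_power_integral _ _) (gauss_power_integral_ge0 alpha (density P (a *: X + b *: Y)%R)).
move=> GX GY GZ GZ0 GY1 GX1 GZ_le.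
have GX0 : 0 < GX by rewrite (lt_le_trans lte01).
have GY0 : 0 < GY by rewrite (lt_le_trans lte01).
(* Distributing over the sum in the extended reals uses that both logarithms are nonnegative, that
   is, both power integrals are at least 1. *)
rewrite -ge0_muleDr ?lne_ge0// -lneM; last 2 first.
  by rewrite in_itv/= GX0 leey.
  by rewrite in_itv/= GY0 leey.
apply: lee_wpmul2l; first by rewrite lee_fin invr_ge0 subr_ge0 ltW.
by rewrite lee_lne// in_itv/= leey andbT// mule_ge0// ltW.
Qed.

Lemma tsallis_entropy_rotation_le (a b : R) (X Y : {RV P >-> R}) :
  (a ^+ 2 + b ^+ 2 = 1)%R -> independent_RV P X Y ->
  1 + (alpha - 1)%R%:E * tsallis_entropy P alpha (a *: X + b *: Y)%R <=
  (1 + (alpha - 1)%R%:E * tsallis_entropy P alpha X) *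
  (1 + (alpha - 1)%R%:E * tsallis_entropy P alpha Y).
Proof.
move=> ab XY.
rewrite [leLHS]tsallis_entropyE [X in _ <= X * _]tsallis_entropyE.
rewrite [X in _ <= _ * X]tsallis_entropyE.
(* Positivity is needed because [+oo * 0 = 0]: only then does one missing density make the
   right-hand side [+oo]. *)
have gt0 (U : {RV P >-> R}) : has_density P U ->
    0 < gauss_power_integral alpha (density P U).
  by move=> /densityP/gauss_power_integral_density_ge1; exact: lt_le_trans lte01.
have [dX|dX] := asboolP (has_density P X); last first.
  by rewrite gt0_mulye ?leey//; case: asboolP => // /gt0.
have [dY|dY] := asboolP (has_density P Y); last first.
  by rewrite gt0_muley ?leey// gt0.
have [dZ] := gauss_power_integral_rotation_le ab XY dX dY.
by rewrite (asboolT dZ).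
Qed.

End divergences.

Theorem proposition9p1 (R : realType) (d : measure_display)
    (T : measurableType d) (P : probability T R) (X Y : {RV P >-> R})
    (alpha : R) (hXY : independent_RV P X Y) (halpha : (1 < alpha)%R)
    (a b : R) (hab : (a ^+ 2 + b ^+ 2 = 1)%R) :
  (renyi_divergence P alpha (a *: X + b *: Y)%R
     <= renyi_divergence P alpha X + renyi_divergence P alpha Y)%E
  /\
  (1 + (alpha - 1)%R%:E * tsallis_entropy P alpha (a *: X + b *: Y)%R
     <= (1 + (alpha - 1)%R%:E * tsallis_entropy P alpha X)
        * (1 + (alpha - 1)%R%:E * tsallis_entropy P alpha Y))%E.
Proof.
by split; [exact: renyi_divergence_rotation_le|exact: tsallis_entropy_rotation_le].
Qed.
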